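(* If $H$ is a hypergraph having no included edges, then $\lambda_1(H)\geq \bar d(H)$, where $\lambda_1(H)$ is the largest eigenvalue of the unified matrix $\mathbf{U}(H)$ and $\bar d(H)$ is the average unified degree of $H$.
   Context: A hypergraph $H$ consists of a finite non-empty vertex set $V(H)$ and a multiset $E(H)$ of non-empty subsets of $V(H)$, called edges; $m(e)$ is the multiplicity of $e$ in $E(H)$. An edge $e$ is included if there is an edge $e'\neq e$ of $H$ with $e\subset e'$. A 2-partition of a set $e$ is an unordered pair $\{S,S'\}$ of non-empty disjoint sets with $S\cup S'=e$; $S$ and $S'$ are called parts of $e$. $I(H)$ is the set of all parts of all edges of $H$ together with all singleton subsets of $V(H)$, and $k=|I(H)|$ is the $e$-index of $H$. The unified matrix $\mathbf{U}(H)$ is the $k\times k$ matrix indexed by $I(H)$ whose $(S,S')$ entry is: $m(S)$ if $S=S'$ is a singleton which is an edge of $H$; $m(e)$ if $\{S,S'\}$ is a 2-partition of an edge $e$ of $H$; and $0$ otherwise. For $S\in I(H)$, the unified degree $d_H(S)$ is the number of edges $e\in E(H)$ (counted with multiplicity) with $S\subseteq e$. The average unified degree is $\bar d(H)=\frac1k\sum_{S\in I(H)}d_H(S)$. *)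

(* Defs.v *)
From HB Require Import structures.
From mathcomp Require Import all_boot all_order all_algebra.
From mathcomp Require Import finmap multiset.
From mathcomp Require Import boolp classical_sets reals.
From mathcomp Require Import polyrcf complex.

Set Implicit Arguments.
Unset Strict Implicit.
Unset Printing Implicit Defensive.

Import Order.TTheory GRing.Theory Num.Theory.
Local Open Scope ring_scope.
Local Open Scope mset_scope.

Record hypergraph := Hypergraph {
  vertex : finType;
  edges : {mset {set vertex}};
  vertex_gt0 : (0 < #|vertex|)%N;
  edge_neq0 : finset.set0 \notin edges
}.

Section HypergraphDefs.
Variable H : hypergraph.
Implicit Types e S T : {set vertex H}.

Definition included e : Prop :=
  exists2 e', e' \in edges H & e != e' /\ e \subset e'.

Definition no_included_edges : Prop :=
  forall e, e \in edges H -> ~ included e.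

Definition is_2partition e S T : bool :=
  [&& S != finset.set0, T != finset.set0, [disjoint S & T] & S :|: T == e].

Definition is_part e S : bool := [exists T, is_2partition e S T].

Definition index_set : {set {set vertex H}} :=
  [set S | [exists e, (e \in edges H) && is_part e S] || (#|S| == 1%N)]%SET.

(* In the second case at most one edge [e] can be picked, namely [S :|: T]. *)
Definition unified_entry S T : nat :=
  if [&& S == T, #|S| == 1%N & S \in edges H] then edges H S
  else if [pick e | (e \in edges H) && is_2partition e S T] is Some e
       then edges H e else 0%N.

Definition unified_mx (R : realType) : 'M[R]_#|index_set| :=
  \matrix_(i, j) (unified_entry (enum_val i) (enum_val j))%:R.

Definition unified_degree S : nat :=
  (\sum_(e : {set vertex H} | S \subset e) edges H e)%N.

Definition avg_unified_degree (R : realType) : R :=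
  (\sum_(S in index_set) (unified_degree S)%:R) / #|index_set|%:R.

End HypergraphDefs.

(* A matrix over [R] has finitely many eigenvalues in [R], and a nonempty
   symmetric matrix has at least one: see [largest_eigenvalueP]. *)
Definition largest_eigenvalue (R : realType) (n : nat) (A : 'M[R]_n) : R :=
  sup [set a | eigenvalue A a]%classic.

Lemma sym_eigenvalue_exists (R : realType) n (A : 'M[R]_n) :
  (0 < n)%N -> A^T = A -> exists a, eigenvalue A a.
Proof.
move=> n0 As.
pose f : {rmorphism R -> R[i]} := real_complex R.
have /closed_rootP[c] : size (char_poly (map_mx f A)) != 1%N.
  by rewrite size_char_poly eqSS -lt0n.
move=> rc; have := rc; rewrite -eigenvalue_root_char => /eigenvalueP[v vA v0].
have cj : c^* = c.
  pose w := (map_mx Num.conj v)^T.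
  have Aw : map_mx f A *m w = c^* *: w.
    rewrite /w -[map_mx f A]trmxK -trmx_mul.
    rewrite matrix.map_trmx As.
    have -> : map_mx f A = map_mx Num.conj (map_mx f A).
      by apply/matrixP=> i j; rewrite !mxE conj_Creal// complex_real.
    by rewrite -map_mxM vA map_mxZ linearZ.
  have : (c^* *: (v *m w)) 0 0 = (c *: (v *m w)) 0 0.
    by rewrite scalemxAr -Aw mulmxA vA scalemxAl.
  rewrite !mxE => /mulIf; apply.
  rewrite psumr_neq0; last by move=> i _; rewrite !mxE -normCK exprn_ge0.
  have /rV0Pn[j vj] := v0; apply/hasP; exists j; first exact: mem_index_enum.
  by rewrite /= !mxE -normCK exprn_gt0 ?normr_gt0.
have /complex_realP[a ca] : c \is Num.real by apply/CrealP.
by exists a; move: rc; rewrite ca -map_char_poly fmorph_root eigenvalue_root_char.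
Qed.

Lemma largest_eigenvalueP (R : realType) n (A : 'M[R]_n) :
  (0 < n)%N -> A^T = A ->
  eigenvalue A (largest_eigenvalue A) /\
  forall a, eigenvalue A a -> a <= largest_eigenvalue A.
Proof.
move=> n0 As; have [a0 a0A] := sym_eigenvalue_exists n0 As.
have p0 : char_poly A != 0 by rewrite -size_poly_eq0 size_char_poly.
pose r := rootsR (char_poly A).
have rE a : eigenvalue A a = (a \in r).
  by have := roots_on_rootsR p0 a; rewrite eigenvalue_root_char in_itv.
have maxr (s : seq R) : s != [::] ->
    exists2 l, l \in s & forall a, a \in s -> a <= l.
  elim: s => // x [_ _|y s IH _].
    by exists x; [rewrite inE | move=> a; rewrite inE => /eqP->].
  have [//|l ls lmax] := IH; have [xl|lx] := leP x l.
    exists l; first by rewrite in_cons ls orbT.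
    by move=> a; rewrite in_cons => /predU1P[->//|/lmax].
  exists x; first exact: mem_head.
  move=> a; rewrite in_cons => /predU1P[->//|/lmax al].
  exact: le_trans al (ltW lx).
have [|l lr lmax] := maxr r.
  by move: a0A; rewrite rE; case: (r).
have lub : ubound [set a | eigenvalue A a]%classic l.
  by move=> a /=; rewrite rE => /lmax.
have -> : largest_eigenvalue A = l.
  apply/eqP; rewrite eq_le /largest_eigenvalue ge_sup//=; last by exists a0.
  apply: ub_le_sup; first by exists l.
  by rewrite /= rE.
by split=> [|a]; rewrite rE // => /lmax.
Qed.

Lemma unified_mx_sym (H : hypergraph) (R : realType) :
  (unified_mx H R)^T = unified_mx H R.
Proof.
apply/matrixP=> i j; rewrite !mxE; congr (_%:R).
move: (enum_val i) (enum_val j) => S T; rewrite /unified_entry.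
have -> : [&& T == S, #|T| == 1%N & T \in edges H]
        = [&& S == T, #|S| == 1%N & S \in edges H].
  by rewrite eq_sym; case: eqP => //= ->.
have -> : [pick e | (e \in edges H) && is_2partition e T S]
        = [pick e | (e \in edges H) && is_2partition e S T].
  congr pick; apply: funext => e; congr (_ && _).
  by rewrite /is_2partition disjoint_sym finset.setUC andbCA.
by case: ifP => // /and3P[/eqP->].
Qed.

Lemma index_set_gt0 (H : hypergraph) : (0 < #|index_set H|)%N.
Proof.
have /card_gt0P[x _] := vertex_gt0 H.
apply/card_gt0P; exists [set x]%SET.
by rewrite finset.inE finset.cards1 eqxx orbT.
Qed.

(* Main.v *)
Require Import Defs.
From mathcomp Require Import all_boot all_order all_algebra.
From mathcomp Require Import reals.
From mathcomp Require Import finmap multiset spectral complex.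

(** The bound is the Rayleigh quotient of the unified matrix U at the all-ones
    vector 1.  For a real symmetric matrix every Rayleigh quotient is at most
    the largest eigenvalue ([rayleigh_le_largest_eigenvalue]), so it is enough
    to see that 1 U 1^T, the sum of all entries of U, is the sum of the unified
    degrees, while 1 1^T is the e-index.

    The absence of included edges makes this true row by row
    ([unified_row_sum]).  In the row of S, an edge e that properly contains S
    contributes m(e) exactly once, in the column of its other part e \ S.  The
    only other edge that contains S is S itself: it contributes m(S) on the
    diagonal when S is a singleton, and contributes nothing otherwise.  But an
    index that is an edge with more than one vertex would be a part of a larger
    edge, hence an included edge, so nothing is missed.

    The Rayleigh bound comes from the spectral theorem over the complex
    numbers: a real symmetric matrix becomes Hermitian, its spectral values are
    real, and they are eigenvalues of the original real matrix. *)

Set Implicit Arguments.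
Unset Strict Implicit.

Import Order.TTheory GRing.Theory Num.Theory.
Local Open Scope ring_scope.

(** * Rayleigh quotients of real symmetric matrices *)

Lemma map_conj_real_complex (R : realType) (m n : nat) (A : 'M[R]_(m, n)) :
  map_mx Num.conj (map_mx (real_complex R) A) = map_mx (real_complex R) A.
Proof. by apply/matrixP=> i j; rewrite !mxE /= [LHS]conjc_real. Qed.

Lemma map_real_complex_hermitian (R : realType) (n : nat) (A : 'M[R]_n) :
  A^T = A -> map_mx (real_complex R) A \is hermsymmx.
Proof.
move=> As; apply/is_hermitianmxP; rewrite expr0 scale1r.
by rewrite matrix.map_trmx As [RHS]map_conj_real_complex.
Qed.

(** Being an eigenvalue is a condition on the characteristic polynomial, and
    this polynomial does not change under the embedding of the reals into the
    complex numbers; so a real spectral value has a real eigenvector, although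
    the rows of the diagonalizing unitary matrix may not be real. *)
Lemma symmetric_spectral_diag_eigenvalue (R : realType) (n : nat)
    (A : 'M[R]_n) (i : 'I_n) : A^T = A ->
  exists2 a : R, eigenvalue A a &
    spectral_diag (map_mx (real_complex R) A) 0 i = (a%:C)%C.
Proof.
move=> /map_real_complex_hermitian Bherm.
set B := map_mx _ A in Bherm *; set P := spectralmx B; set d := spectral_diag B.
have PB : P *m B = diag_mx d *m P.
  rewrite [in LHS](orthomx_spectralP (hermitian_normalmx Bherm)).
  by rewrite -mulmxA mulKVmx ?spectral_unit.
have /complex_realP[a da] : d 0 i \is Num.real.
  by have /mxOverP := hermitian_spectral_diag_real Bherm; apply.
exists a; last exact: da.
rewrite eigenvalue_root_char -(fmorph_root (real_complex R)) map_char_poly.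
rewrite -eigenvalue_root_char.
apply/eigenvalueP; exists (row i P).
  by rewrite -row_mul PB row_mul row_diag_mx -scalemxAl -rowE da.
rewrite rowE mulmx_free_eq0; last by rewrite row_free_unit spectral_unit.
by apply/eqP=> /rowP/(_ i)/eqP; rewrite !mxE !eqxx oner_eq0.
Qed.

(** In the coordinates w of u along an orthonormal eigenbasis, u A u^T is the
    sum of the d_i |w_i|^2 and u u^T is the sum of the |w_i|^2, where the d_i
    are eigenvalues of A. *)
Lemma rayleigh_le_largest_eigenvalue (R : realType) (n : nat) (A : 'M[R]_n)
    (u : 'rV[R]_n) : (0 < n)%N -> A^T = A ->
  (u *m A *m u^T) 0 0 <= largest_eigenvalue A * (u *m u^T) 0 0.
Proof.
move=> n0 As; have [_ lmax] := largest_eigenvalueP n0 As.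
set l := largest_eigenvalue A in lmax *.
pose f := real_complex R; pose B := map_mx f A.
have Bherm : B \is hermsymmx := map_real_complex_hermitian As.
pose P := spectralmx B; pose d := spectral_diag B.
have Pu : P \is unitarymx := spectral_unitarymx B.
pose w := map_mx f u *m invmx P.
have wE : map_mx Num.conj w^T = P *m (map_mx f u)^T.
  rewrite /w invmx_unitary // trmx_mul map_mxM; congr (_ *m _).
    by rewrite -matrix.map_trmx trmxK -map_mx_comp map_mx_id //; apply: conjCK.
  by rewrite -matrix.map_trmx map_conj_real_complex.
have normE : f ((u *m u^T) 0 0) = \sum_i `|w 0 i| ^+ 2.
  transitivity ((w *m map_mx Num.conj w^T) 0 0).
    rewrite wE mulmxA /w mulmxKV ?spectral_unit //.
    by rewrite matrix.map_trmx -map_mxM [RHS]mxE.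
  by rewrite mxE; apply: eq_bigr => i _; rewrite !mxE normCK.
have formE : f ((u *m A *m u^T) 0 0) = \sum_i d 0 i * `|w 0 i| ^+ 2.
  transitivity ((w *m diag_mx d *m map_mx Num.conj w^T) 0 0).
    have wBE : w *m diag_mx d *m P = map_mx f u *m B.
      rewrite [in RHS](orthomx_spectralP (hermitian_normalmx Bherm)).
      by rewrite /w !mulmxA.
    by rewrite wE mulmxA wBE matrix.map_trmx -!map_mxM [RHS]mxE.
  rewrite mxE; apply: eq_bigr => i _.
  by rewrite mul_mx_diag !mxE normCK mulrAC mulrC mulrA.
rewrite -lecR [leRHS]rmorphM /= [leLHS]formE [X in _ * X]normE mulr_sumr.
apply: ler_sum => i _; apply: ler_wpM2r; first exact: exprn_ge0.
have [a /lmax al] := symmetric_spectral_diag_eigenvalue i As.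
by rewrite -/d => ->; rewrite lecR.
Qed.

(** * Row sums of the unified matrix *)

Lemma rowsum_quadratic_form (R : nzRingType) (n : nat) (A : 'M[R]_n) :
  ((const_mx 1 : 'rV_n) *m A *m (const_mx 1 : 'rV_n)^T) 0 0
    = \sum_i \sum_j A i j.
Proof.
rewrite exchange_big mxE; apply: eq_bigr => j _.
by rewrite !mxE mulr1; apply: eq_bigr => i _; rewrite mxE mul1r.
Qed.

Section UnifiedRowSums.
Variable H : hypergraph.
Implicit Types e S T : {set vertex H}.

Lemma index_set_neq0 S : S \in index_set H -> S != finset.set0.
Proof.
rewrite inE => /orP[/existsP[e /andP[_ /existsP[T /and4P[]]]] //|].
by apply: contraTneq => ->; rewrite cards0.
Qed.

(** This is where the absence of included edges enters: an index with several
    vertices is a proper subset of an edge, because the complementary part is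
    nonempty. *)
Lemma index_set_edge_singleton S :
  no_included_edges H -> S \in index_set H -> S \in edges H -> #|S| == 1%N.
Proof.
move=> noinc; rewrite inE => /orP[|//] /existsP[e /andP[eH /existsP[T ST]]] SH.
case: (noinc S SH); exists e => //.
have /and4P[_ T0 dST /eqP eE] := ST; rewrite -eE subsetUl; split=> //.
apply: contraNneq T0 => SE; rewrite -subset0 -(disjoint_setI0 dST) subsetI subxx.
by rewrite andbT SE subsetUr.
Qed.

(** The two sources of a nonzero entry never overlap, since a nonempty set is
    not disjoint from itself; this turns the case distinction into a sum that
    can be split over a row.  The second summand needs no condition that the
    union is an edge: its multiplicity vanishes when it is not. *)
Lemma unified_entryE S T : S != finset.set0 ->
  unified_entry S T =
    ((if (T == S) && (#|S| == 1) then edges H S else 0) +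
     (if (T != finset.set0) && [disjoint S & T] then edges H (S :|: T) else 0))%N.
Proof.
move=> S0; rewrite /unified_entry [S == T]eq_sym.
have pickE : (if [pick e | (e \in edges H) && is_2partition e S T] is Some e
              then edges H e else 0%N) =
    (if (T != finset.set0) && [disjoint S & T] then edges H (S :|: T) else 0)%N.
  case: pickP => [e /andP[_ /and4P[_ -> -> /eqP->]] //|npart].
  case: ifP => // /andP[T0 dST]; have := npart (S :|: T).
  rewrite /is_2partition S0 T0 dST eqxx /= andbT => /negbT.
  by rewrite -mset_eq0 => /eqP.
rewrite pickE; case: (T =P S) => [->|//] /=.
rewrite -setI_eq0 finset.setIid (negbTE S0) andbF addn0.
case: ifP => [/andP[-> //]|]; case: (#|S| == 1%N) => //= /negbT.
by rewrite -mset_eq0 => /eqP.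
Qed.

(** Double counting: T |-> S :|: T and e |-> e :\: S are inverse bijections
    between the second parts T and the edges e properly containing S.  Sets that
    are not edges must be discarded on both sides first, because their
    complements e :\: S need not be indices. *)
Lemma sum_proper_superedges S : S != finset.set0 ->
  (\sum_(T in index_set H | (T != finset.set0) && [disjoint S & T])
     edges H (S :|: T) = \sum_(e : {set vertex H} | S \proper e) edges H e)%N.
Proof.
move=> S0; rewrite (bigID (fun T => S :|: T \in edges H)) /=.
rewrite [X in (_ + X)%N]big1 ?addn0 => [|T /andP[_]]; last first.
  by rewrite -mset_eq0 => /eqP.
rewrite [RHS](bigID (mem (edges H))) /=.
rewrite [X in (_ = _ + X)%N]big1 ?addn0 => [|e /andP[_]]; last first.
  by rewrite -mset_eq0 => /eqP.
rewrite [RHS](reindex_onto (fun T => S :|: T) (fun e => e :\: S)) /=; last first.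
  move=> e /andP[/proper_sub Se _].
  by rewrite -[in RHS](finset.setID e S) (setIidPr Se).
apply: eq_bigl => T; apply/idP/idP.
  case/andP=> /and3P[TI T0 dST] STE.
  have DST : (S :|: T) :\: S = T.
    rewrite finset.setDUl finset.setDv set0U; apply/setDidPl.
    by rewrite disjoint_sym.
  rewrite STE DST eqxx !andbT properEneq subsetUl andbT.
  by apply: contraNneq T0 => SE; rewrite -DST -SE finset.setDv.
case/andP=> /andP[pST STE] /eqP DST; rewrite STE andbT.
have dST : [disjoint S & T].
  by rewrite -DST disjoint_sym disjoints_subset setDE subsetIr.
have T0 : T != finset.set0.
  by rewrite -DST finset.setD_eq0 proper_subn.
rewrite T0 dST !andbT inE; apply/orP; left.
apply/existsP; exists (S :|: T); rewrite STE; apply/existsP; exists S.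
by rewrite /is_2partition T0 S0 disjoint_sym dST finset.setUC eqxx.
Qed.

Lemma unified_row_sum S : no_included_edges H -> S \in index_set H ->
  (\sum_(T in index_set H) unified_entry S T = unified_degree S)%N.
Proof.
move=> noinc SI; have S0 := index_set_neq0 SI.
under eq_bigr do rewrite unified_entryE //.
rewrite big_split /= -(big_mkcondr _ _ (mem (index_set H))) /=.
rewrite -[in X in (_ + X)%N]big_mkcondr sum_proper_superedges //.
rewrite /unified_degree [RHS](bigD1 S) //=; congr (_ + _)%N; last first.
  by apply: eq_bigl => e; rewrite properEneq andbC eq_sym.
have [S1|S1] := boolP (#|S| == 1%N).
  rewrite (big_pred1 S) // => T /=.
  by rewrite andbT; case: eqP => [->|]; rewrite ?SI ?andbF.
rewrite big_pred0 => [|T]; last by rewrite !andbF.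
apply/esym/eqP; rewrite mset_eq0.
by apply: contra S1; apply: index_set_edge_singleton.
Qed.

End UnifiedRowSums.

Unset Implicit Arguments.
Set Strict Implicit.

Theorem theorem9p8 (R : realType) (H : hypergraph) :
  no_included_edges H ->
  avg_unified_degree H R <= largest_eigenvalue (unified_mx H R).
Proof.
move=> noinc; have I0 := index_set_gt0 H.
have := rayleigh_le_largest_eigenvalue (const_mx 1) I0 (unified_mx_sym H R).
rewrite rowsum_quadratic_form.
have -> : \sum_i \sum_j unified_mx H R i j
    = \sum_(S in index_set H) (unified_degree S)%:R.
  rewrite [RHS]big_enum_val /=; apply: eq_bigr => i _.
  rewrite -unified_row_sum ?enum_valP // natr_sum [RHS]big_enum_val /=.
  by apply: eq_bigr => j _; rewrite mxE.
have -> : ((const_mx 1 : 'rV[R]_#|index_set H|) *m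
           (const_mx 1 : 'rV_#|index_set H|)^T) 0 0 = #|index_set H|%:R.
  rewrite mxE (eq_bigr (fun=> 1)) => [|i _]; first by rewrite sumr_const card_ord.
  by rewrite !mxE mulr1.
by rewrite /avg_unified_degree ler_pdivrMr ?ltr0n.
Qed.
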